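(* Let $\rho_{AB}$ be a state on $A\otimes B$ with $\dim A=2$ and $B$ finite-dimensional. Then $$\min_{\{|a_0\rangle,|a_1\rangle\}}\big\|\rho_{AB}-\Pi_{\{|a_k\rangle\}}[\rho_{AB}]\big\|_1=\min_{\sigma\in\mathcal{CQ}}\|\rho_{AB}-\sigma\|_1,$$ where the left minimum is over orthonormal bases of $A$, $\Pi_{\{|a_k\rangle\}}[X]=\sum_k(|a_k\rangle\langle a_k|\otimes\mathbb I_B)X(|a_k\rangle\langle a_k|\otimes\mathbb I_B)$, and $\mathcal{CQ}$ is the set of classical-quantum states.
   Context: $\|\cdot\|_1$ is the trace norm. A state $\sigma_{AB}$ is classical-quantum (classical on $A$) if it can be written as $\sigma_{AB}=\sum_j|a_j\rangle\langle a_j|\otimes\sigma_j$ for some orthonormal basis $\{|a_j\rangle\}$ of $A$ and positive semidefinite operators $\sigma_j$ on $B$ (with $\sum_j\operatorname{Tr}\sigma_j=1$). *)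

(* Defs.v *)
From HB Require Import structures.
From mathcomp Require Import all_boot all_order all_algebra.
From mathcomp Require Import complex mxtens.
From mathcomp Require Import boolp reals.
Set Implicit Arguments. Unset Strict Implicit. Unset Printing Implicit Defensive.
Import Order.TTheory GRing.Theory Num.Theory.
Local Open Scope ring_scope.

Section Q.
Variable R : realType.
Local Notation C := R[i].

Definition adjmx m n (A : 'M[C]_(m, n)) : 'M[C]_(n, m) := (map_mx Num.conj A)^T.

Definition psd n (M : 'M[C]_n) : Prop :=
  adjmx M = M /\ forall v : 'cV[C]_n, 0 <= (adjmx v *m M *m v) 0 0.

Definition is_state n (M : 'M[C]_n) : Prop := psd M /\ \tr M = 1.

(* the (unique) PSD square root of a PSD matrix; 0 if none exists *)
Definition psd_sqrt n (M : 'M[C]_n) : 'M[C]_n :=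
  match pselect (exists P : 'M[C]_n, psd P /\ P *m P = M) with
  | left h => proj1_sig (cid h)
  | right _ => 0
  end.

Definition trnorm n (X : 'M[C]_n) : R := complex.Re (\tr (psd_sqrt (adjmx X *m X))).

Definition orthonormal2 (a : 'I_2 -> 'cV[C]_2) : Prop :=
  forall j k : 'I_2, (adjmx (a j) *m a k) 0 0 = (j == k)%:R.

Definition proj2 (v : 'cV[C]_2) : 'M[C]_2 := v *m adjmx v.

Definition dephase n (a : 'I_2 -> 'cV[C]_2) (X : 'M[C]_(2 * n)) : 'M[C]_(2 * n) :=
  \sum_(k < 2) (proj2 (a k) *t (1%:M : 'M[C]_n)) *m X *m (proj2 (a k) *t (1%:M : 'M[C]_n)).

Definition is_cq n (s : 'M[C]_(2 * n)) : Prop :=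
  exists (a : 'I_2 -> 'cV[C]_2) (sj : 'I_2 -> 'M[C]_n),
    [/\ orthonormal2 a, (forall j, psd (sj j)),
        \sum_(j < 2) \tr (sj j) = 1 &
        s = \sum_(j < 2) (proj2 (a j) *t sj j)].
End Q.

(* Main.v *)
Require Import Defs.
From HB Require Import structures.
From mathcomp Require Import all_boot all_order all_algebra.
From mathcomp Require Import complex mxtens.
From mathcomp Require Import boolp reals.
From mathcomp Require Import classical_sets topology normedtype realfun derive.
From mathcomp Require Import ring lra.
Import Order.TTheory GRing.Theory Num.Theory.
Import numFieldNormedType.Exports.
Local Open Scope ring_scope.

Set Implicit Arguments.
Unset Strict Implicit.
Unset Printing Implicit Defensive.

(** For a Hermitian X the trace norm is the maximum of Re tr (W X) over unitary
    matrices W.  If a is an orthonormal basis of A and Z is the reflection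
    (|a_0><a_0| - |a_1><a_1|) (x) 1, then Y - Pi_a[Y] = (Y - Z Y Z) / 2, so
    passing from Y to Y - Pi_a[Y] does not increase the trace norm.  A
    classical-quantum state sigma with basis a is fixed by Pi_a; taking
    Y = rho - sigma shows that Pi_a[rho], which is itself classical-quantum, is
    at least as close to rho as sigma.  The minimum over bases is attained
    because Pi_a depends only on the unit vector a_0, which ranges over the
    compact sphere S^3, and the trace norm is continuous. *)

(** * The trace norm of Hermitian matrices *)

Section TraceNorm.
Variable R : realType.
Local Notation C := R[i].
Local Notation Re := (@complex.Re R).
Local Notation Im := (@complex.Im R).

(** * Real and imaginary parts of complex numbers *)

Lemma Re_add (z w : C) : Re (z + w) = Re z + Re w.
Proof. by case: z w => ? ? [? ?]. Qed.

Lemma Re_opp (z : C) : Re (- z) = - Re z.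
Proof. by case: z. Qed.

Lemma Im_add (z w : C) : Im (z + w) = Im z + Im w.
Proof. by case: z w => ? ? [? ?]. Qed.

Lemma Re_mul (z w : C) : Re (z * w) = Re z * Re w - Im z * Im w.
Proof. by case: z w => ? ? [? ?]. Qed.

Lemma Im_mul (z w : C) : Im (z * w) = Re z * Im w + Im z * Re w.
Proof. by case: z w => ? ? [? ?]. Qed.

Lemma Re_sum (I : Type) (r : seq I) (P : pred I) (F : I -> C) :
  Re (\sum_(i <- r | P i) F i) = \sum_(i <- r | P i) Re (F i).
Proof. exact: (big_morph _ Re_add). Qed.

Lemma Re_conjc (z : C) : Re (Num.conj z) = Re z.
Proof. by case: z. Qed.

Lemma Im_conjc (z : C) : Im (Num.conj z) = - Im z.
Proof. by case: z. Qed.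

Lemma Re_mul_conj (z : C) : Re (z * Num.conj z) = Re z ^+ 2 + Im z ^+ 2.
Proof. by rewrite Re_mul Re_conjc Im_conjc; ring. Qed.

(** * Algebra of the adjoint *)

Lemma adjmxE m n (A : 'M[C]_(m, n)) i j : adjmx A i j = Num.conj (A j i).
Proof. by rewrite !mxE. Qed.

Lemma adjmx_map_tr m n (A : 'M[C]_(m, n)) : adjmx A = map_mx Num.conj A^T.
Proof. by rewrite /adjmx map_trmx. Qed.

Lemma adjmxK m n (A : 'M[C]_(m, n)) : adjmx (adjmx A) = A.
Proof. by apply/matrixP => i j; rewrite !adjmxE conjCK. Qed.

Lemma adjmxM m n p (A : 'M[C]_(m, n)) (B : 'M[C]_(n, p)) :
  adjmx (A *m B) = adjmx B *m adjmx A.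
Proof. by rewrite /adjmx map_mxM trmx_mul. Qed.

Lemma adjmxD m n (A B : 'M[C]_(m, n)) : adjmx (A + B) = adjmx A + adjmx B.
Proof. by apply/matrixP => i j; rewrite !(mxE, adjmxE) rmorphD. Qed.

Lemma adjmxN m n (A : 'M[C]_(m, n)) : adjmx (- A) = - adjmx A.
Proof. by apply/matrixP => i j; rewrite !(mxE, adjmxE) rmorphN. Qed.

Lemma adjmxZ m n a (A : 'M[C]_(m, n)) : adjmx (a *: A) = Num.conj a *: adjmx A.
Proof. by apply/matrixP => i j; rewrite !(mxE, adjmxE) rmorphM. Qed.

Lemma adjmx1 n : adjmx (1%:M : 'M[C]_n) = 1%:M.
Proof. by rewrite adjmx_map_tr trmx1 map_mx1. Qed.

Lemma adjmx_diag n (d : 'rV[C]_n) :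
  adjmx (diag_mx d) = diag_mx (map_mx Num.conj d).
Proof. by rewrite adjmx_map_tr tr_diag_mx map_diag_mx. Qed.

Lemma map_real_diag n (d : 'rV[R]_n) :
  map_mx Num.conj (map_mx (real_complex R) d) = map_mx (real_complex R) d :> 'rV[C]_n.
Proof.
by apply/rowP => i; rewrite !mxE; apply/eqP; rewrite eq_complex /= oppr0 !eqxx.
Qed.

(** * Spectral decompositions and positive square roots *)

Lemma mx_trace_diag_conj n (U : 'M[C]_n) (d : 'rV[C]_n) :
  U *m adjmx U = 1%:M -> \tr (adjmx U *m diag_mx d *m U) = \sum_i d 0 i.
Proof. by move=> UU; rewrite mxtrace_mulC mulmxA UU mul1mx mxtrace_diag. Qed.

(** The spectral theorem for normal matrices applies; the eigenvalues of a Hermitian matrix are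
    real, so storing them in [R] loses nothing. *)
Lemma hermitian_spectral n (A : 'M[C]_n) : adjmx A = A ->
  exists (U : 'M[C]_n) (d : 'rV[R]_n),
    [/\ U *m adjmx U = 1%:M, adjmx U *m U = 1%:M &
        A = adjmx U *m diag_mx (map_mx (real_complex R) d) *m U].
Proof.
move=> hA.
have A_herm : A \is hermsymmx.
  by apply/is_hermitianmxP; rewrite expr0 scale1r -adjmx_map_tr hA.
have U_unitary := spectral_unitarymx A.
have UU : spectralmx A *m adjmx (spectralmx A) = 1%:M.
  by rewrite adjmx_map_tr; apply/unitarymxP.
exists (spectralmx A), (map_mx Re (spectral_diag A)).
split=> //; first exact: mulmx1C.
have /orthomx_spectralP {1}-> := hermitian_normalmx A_herm.
rewrite (invmx_unitary U_unitary) -adjmx_map_tr; congr (_ *m diag_mx _ *m _).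
apply/rowP => i; rewrite !mxE RRe_real //.
exact: (mxOverP (hermitian_spectral_diag_real A_herm)).
Qed.

Lemma psd_conj m n (A : 'M[C]_(m, n)) (P : 'M[C]_m) :
  psd P -> psd (adjmx A *m P *m A).
Proof.
case=> hP P_ge0; split; first by rewrite !adjmxM adjmxK hP mulmxA.
by move=> v; have := P_ge0 (A *m v); rewrite adjmxM !mulmxA.
Qed.

Lemma psd_diag n (d : 'rV[R]_n) :
  (forall i, 0 <= d 0 i) -> psd (diag_mx (map_mx (real_complex R) d)).
Proof.
move=> d_ge0; split; first by rewrite adjmx_diag map_real_diag.
move=> v; rewrite mul_mx_diag mxE; apply: sumr_ge0 => i _.
by rewrite mxE adjmxE mxE mulrAC mulr_ge0 ?ler0c // mulrC mul_conjC_ge0.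
Qed.

(** Replacing the eigenvalues of [X] by their absolute values gives the root. Hence [psd_sqrt] does
    not fall back on its default [0] in [trnorm X]. *)
Lemma psd_sqrt_exists n (X : 'M[C]_n) : adjmx X = X ->
  exists P, psd P /\ P *m P = adjmx X *m X.
Proof.
move=> hX; have [U [d [UU _ ->]]] := hermitian_spectral hX.
exists (adjmx U *m diag_mx (map_mx (real_complex R) (map_mx Num.norm d)) *m U).
split; first by apply/psd_conj/psd_diag => i; rewrite mxE normr_ge0.
rewrite !adjmxM adjmxK adjmx_diag map_real_diag !mulmxA.
rewrite -2!(mulmxA _ U (adjmx U)) UU !mulmx1.
congr (_ *m _); rewrite -!mulmxA; congr (_ *m _).
rewrite !mulmx_diag; congr diag_mx; apply/rowP => i; rewrite !mxE.
by rewrite -!rmorphM /= -normrM ger0_norm // -expr2 sqr_ge0.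
Qed.

Lemma psd_sqrtP n (X : 'M[C]_n) : adjmx X = X ->
  psd (psd_sqrt (adjmx X *m X)) /\
  psd_sqrt (adjmx X *m X) *m psd_sqrt (adjmx X *m X) = adjmx X *m X.
Proof.
move=> hX; rewrite /psd_sqrt; case: pselect => [h|[]]; last exact: psd_sqrt_exists.
exact: (projT2 (cid h)).
Qed.

(** * The trace norm as a maximum over unitaries *)

Lemma Re_diag_mul_adj m n (A : 'M[C]_(m, n)) i :
  Re ((A *m adjmx A) i i) = \sum_k (Re (A i k) ^+ 2 + Im (A i k) ^+ 2).
Proof.
by rewrite mxE Re_sum; apply: eq_bigr => k _; rewrite adjmxE Re_mul_conj.
Qed.

(** Entry [i] of the diagonal pairs row [i] of [A], of norm 1, with column [i] of [B], of norm
    [t i]. Both halves of the variational formula and the Lipschitz bound reduce to this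
    estimate. *)
Lemma Re_trace_mul_le m n (A : 'M[C]_(m, n)) (B : 'M[C]_(n, m)) (t : 'I_m -> R) :
  (forall i, Re ((A *m adjmx A) i i) = 1) ->
  (forall i, Re ((adjmx B *m B) i i) = t i ^+ 2) ->
  (forall i, 0 <= t i) ->
  Re (\tr (A *m B)) <= \sum_i t i.
Proof.
move=> hA hB t_ge0; rewrite /mxtrace Re_sum; apply: ler_sum => i _.
set r := Re _.
(* Cauchy-Schwarz for the [i]-th diagonal entry, as [|r A_i - B_i^*|^2 >= 0]. *)
suff : 2 * r * r <= r ^+ 2 * Re ((A *m adjmx A) i i) + Re ((adjmx B *m B) i i).
  rewrite hA hB; move: (t_ge0 i) => ti hr; rewrite leNgt; apply/negP => tr; nra.
have hB' : Re ((adjmx B *m B) i i)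
    = \sum_k (Re (B k i) ^+ 2 + Im (B k i) ^+ 2).
  rewrite -{2}[B]adjmxK Re_diag_mul_adj; apply: eq_bigr => k _.
  by rewrite adjmxE Re_conjc Im_conjc sqrrN.
rewrite hB' Re_diag_mul_adj mulr_sumr -big_split /=.
rewrite {2}/r mxE Re_sum mulr_sumr; apply: ler_sum => k _; rewrite Re_mul.
set a := Re (A i k); set b := Im (A i k); set c := Re _; set d := Im _.
rewrite -subr_ge0.
have -> : r ^+ 2 * (a ^+ 2 + b ^+ 2) + (c ^+ 2 + d ^+ 2) - 2 * r * (a * c - b * d)
  = (r * a - c) ^+ 2 + (r * b + d) ^+ 2 by ring.
by rewrite addr_ge0 ?sqr_ge0.
Qed.

Lemma psd_spectral n (P : 'M[C]_n) : psd P ->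
  exists (U : 'M[C]_n) (d : 'rV[R]_n),
    [/\ U *m adjmx U = 1%:M, adjmx U *m U = 1%:M, forall i, 0 <= d 0 i &
        P = adjmx U *m diag_mx (map_mx (real_complex R) d) *m U].
Proof.
case=> hP P_ge0; have [U [d [UU UU' defP]]] := hermitian_spectral hP.
exists U, d; split=> // i.
have : U *m P *m adjmx U = diag_mx (map_mx (real_complex R) d).
  by rewrite defP !mulmxA UU mul1mx -mulmxA UU mulmx1.
move/matrixP/(_ i i); rewrite [RHS]mxE eqxx mulr1n [RHS]mxE => dE.
(* The quadratic form at the eigenvector [adjmx (row i U)] equals the eigenvalue [d 0 i]. *)
have := P_ge0 (adjmx (row i U)); rewrite adjmxK -row_mul -ler0c => h.
rewrite -dE; apply: (le_trans h); rewrite le_eqVlt; apply/orP; left.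
by apply/eqP; rewrite mxE [RHS]mxE; apply: eq_bigr => k _; rewrite !mxE.
Qed.

(* Tracing in an eigenbasis of [psd_sqrt _] here, and of [X] in the converse
   bound, makes the uniqueness of the square root unnecessary. *)
Lemma Re_trace_unitary_le_trnorm n (X W : 'M[C]_n) :
  adjmx X = X -> W *m adjmx W = 1%:M -> Re (\tr (W *m X)) <= trnorm X.
Proof.
move=> hX WW; have [psdP PP] := psd_sqrtP hX; rewrite /trnorm.
set P := psd_sqrt _ in psdP PP *.
have [U [d [UU UU' d_ge0 defP]]] := psd_spectral psdP.
have -> : Re (\tr P) = \sum_i d 0 i.
  by rewrite defP mx_trace_diag_conj // Re_sum; apply: eq_bigr => i _; rewrite mxE.
have -> : \tr (W *m X) = \tr ((U *m W) *m (X *m adjmx U)).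
  by rewrite mulmxA [RHS]mxtrace_mulC !mulmxA UU' mul1mx.
(* The rows of [U *m W] are unit vectors by unitarity. Column [i] of [X *m adjmx U] has squared norm
   [d 0 i ^+ 2], because [adjmx X *m X = P *m P] and [U] diagonalizes [P]. *)
apply: Re_trace_mul_le => // i.
  by rewrite adjmxM mulmxA -(mulmxA U) WW mulmx1 UU mxE eqxx.
rewrite adjmxM adjmxK mulmxA -(mulmxA U) -PP defP !mulmxA UU mul1mx.
rewrite -2!(mulmxA _ U (adjmx U)) UU !mulmx1 mulmx_diag !mxE eqxx mulr1n.
by rewrite -rmorphM /= expr2.
Qed.

(** The optimal [W] is the sign of [X], built in an eigenbasis of [X], so that the trace of [W *m X]
    is the sum of the absolute eigenvalues. In the same basis, column [i] of [P *m adjmx U] has norm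
    [|d 0 i|], which bounds the trace of [P] by that sum. *)
Lemma trnorm_attained n (X : 'M[C]_n) : adjmx X = X ->
  exists W, W *m adjmx W = 1%:M /\ trnorm X <= Re (\tr (W *m X)).
Proof.
move=> hX; have [[hP _] PP] := psd_sqrtP hX; rewrite /trnorm.
set P := psd_sqrt _ in hP PP *.
have [U [d [UU UU' defX]]] := hermitian_spectral hX.
(* A zero eigenvalue gets sign 1, not 0, to keep [W] unitary. *)
pose s := \row_i (if 0 <= d 0 i then 1 else -1 : R).
exists (adjmx U *m diag_mx (map_mx (real_complex R) s) *m U); split.
  rewrite !adjmxM adjmxK adjmx_diag map_real_diag !mulmxA.
  rewrite -(mulmxA _ U (adjmx U)) UU mulmx1 -(mulmxA (adjmx U)) mulmx_diag.
  rewrite (_ : diag_mx _ = 1%:M) ?mulmx1 //; apply/matrixP => i j.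
  rewrite !mxE; case: eqP => // ->; rewrite !mulr1n -rmorphM /=.
  by case: ifP; rewrite ?mulrNN mulr1.
have -> : \tr (adjmx U *m diag_mx (map_mx (real_complex R) s) *m U *m X)
    = (\sum_i `|d 0 i|)%:C%C.
  rewrite defX !mulmxA -(mulmxA _ U (adjmx U)) UU mulmx1.
  rewrite -(mulmxA (adjmx U)) mulmx_diag mx_trace_diag_conj // rmorph_sum /=.
  apply: eq_bigr => i _; rewrite !mxE -rmorphM /=; congr (_%:C%C).
  by case: ifP => [/ger0_norm ->|/negbT]; rewrite ?mul1r // -ltNge mulN1r => /ltr0_norm.
have -> : \tr P = \tr (U *m (P *m adjmx U)).
  by rewrite mulmxA [RHS]mxtrace_mulC mulmxA UU' mul1mx.
apply: Re_trace_mul_le => // i.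
  by rewrite UU mxE eqxx.
rewrite adjmxM adjmxK hP mulmxA -(mulmxA U) PP hX defX !mulmxA UU mul1mx.
rewrite -2!(mulmxA _ U (adjmx U)) UU !mulmx1 mulmx_diag !mxE eqxx mulr1n.
by rewrite -rmorphM /= -normrX ger0_norm ?sqr_ge0 // expr2.
Qed.

(** With [W] optimal for the left side, cyclicity moves the conjugation by [Z] from [Y] onto [W].
    The left side is then at most the average of two values of the trace functional of [Y], at the
    unitaries [W] and [- (Z *m W *m Z)]. *)
Lemma trnorm_pinch_le n (Z Y : 'M[C]_n) :
  adjmx Z = Z -> Z *m Z = 1%:M -> adjmx Y = Y ->
  trnorm (2^-1 *: (Y - Z *m Y *m Z)) <= trnorm Y.
Proof.
move=> hZ ZZ hY.
have [|W [WW hW]] := @trnorm_attained n (2^-1 *: (Y - Z *m Y *m Z)).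
  by rewrite adjmxZ fmorphV rmorph_nat adjmxD adjmxN !adjmxM hZ hY mulmxA.
apply: (le_trans hW).
have h1 := Re_trace_unitary_le_trnorm hY WW.
have h2 : Re (\tr ((- (Z *m W *m Z)) *m Y)) <= trnorm Y.
  apply: Re_trace_unitary_le_trnorm => //.
  rewrite adjmxN mulNmx mulmxN opprK !adjmxM hZ !mulmxA.
  by rewrite -(mulmxA _ Z Z) ZZ mulmx1 -(mulmxA Z) WW mulmx1 ZZ.
have -> : \tr (W *m (2^-1 *: (Y - Z *m Y *m Z))) =
    2^-1 * (\tr (W *m Y) + \tr ((- (Z *m W *m Z)) *m Y)).
  rewrite -scalemxAr mxtraceZ; congr (_ * _).
  rewrite mulmxBr raddfB mulNmx raddfN /=; congr (_ - _).
  by rewrite -!mulmxA [RHS]mxtrace_mulC !mulmxA.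
have -> : 2^-1 = (2^-1 : R)%:C%C :> C by rewrite fmorphV rmorph_nat.
by rewrite Re_mul Re_add /=; lra.
Qed.

(** A unitary optimal for [X] is admissible for [Y], so the difference is at most
    [Re (\tr (W *m (X - Y)))], hence at most the sum of the column norms of [X - Y]. *)
Lemma trnorm_lipschitz n (X Y : 'M[C]_n) : adjmx X = X -> adjmx Y = Y ->
  trnorm X - trnorm Y <=
  \sum_i Num.sqrt (Re ((adjmx (X - Y) *m (X - Y)) i i)).
Proof.
move=> hX hY; have [W [WW hW]] := trnorm_attained hX.
have h := Re_trace_unitary_le_trnorm hY WW.
apply: (@le_trans _ _ (Re (\tr (W *m (X - Y))))).
  rewrite mulmxBr raddfB /= Re_add Re_opp; lra.
apply: Re_trace_mul_le => i; first by rewrite WW mxE eqxx.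
  rewrite sqr_sqrtr // -{2}[X - Y]adjmxK Re_diag_mul_adj.
  by apply: sumr_ge0 => k _; rewrite addr_ge0 ?sqr_ge0.
exact: sqrtr_ge0.
Qed.

End TraceNorm.

(** * Dephasing *)

Section Dephasing.
Variable R : realType.
Local Notation C := R[i].

Lemma sum_ord2 (V : nmodType) (F : 'I_2 -> V) : \sum_k F k = F 0 + F 1.
Proof. by rewrite big_ord_recl big_ord1; congr (_ + F _); exact: val_inj. Qed.

Lemma tensmx11 m n : 1%:M *t 1%:M = 1%:M :> 'M[C]_(m * n).
Proof.
apply/matrixP => i j.
case: (mxtens_indexP i) => i1 i2; case: (mxtens_indexP j) => j1 j2.
by rewrite tensmxE !mxE (can_eq (@mxtens_indexK _ _)) xpair_eqE -natrM mulnb.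
Qed.

Lemma tensmxDl m n p q (A B : 'M[C]_(m, n)) (M : 'M[C]_(p, q)) :
  (A + B) *t M = A *t M + B *t M.
Proof. by apply/matrixP => i j; rewrite !mxE mulrDl. Qed.

Lemma adjmx_tens m n p q (A : 'M[C]_(m, n)) (B : 'M[C]_(p, q)) :
  adjmx (A *t B) = adjmx A *t adjmx B.
Proof. by rewrite /adjmx map_mxT trmx_tens. Qed.

Lemma adjmx_proj2 (v : 'cV[C]_2) : adjmx (proj2 v) = proj2 v.
Proof. by rewrite /proj2 adjmxM adjmxK. Qed.

Lemma orthonormal2_mulmx (a : 'I_2 -> 'cV[C]_2) j k : orthonormal2 a ->
  adjmx (a j) *m a k = (j == k)%:R%:M.
Proof. by move=> oa; rewrite [LHS]mx11_scalar oa. Qed.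

Lemma proj2M (a : 'I_2 -> 'cV[C]_2) j k : orthonormal2 a ->
  proj2 (a j) *m proj2 (a k) = if j == k then proj2 (a j) else 0.
Proof.
move=> oa; rewrite /proj2 mulmxA -(mulmxA (a j)) orthonormal2_mulmx //.
by case: eqP => [->|_]; rewrite ?mulmx1 // raddf0 mulmx0 mul0mx.
Qed.

Lemma sum_proj2 (a : 'I_2 -> 'cV[C]_2) : orthonormal2 a ->
  proj2 (a 0) + proj2 (a 1) = 1%:M.
Proof.
(* With the basis vectors as columns of the square matrix [A], orthonormality is
   [adjmx A *m A = 1%:M]; the reversed product is the completeness relation. *)
move=> oa; pose A : 'M[C]_2 := \matrix_(i, k) a k i 0.
have AA : adjmx A *m A = 1%:M.
  apply/matrixP => j k; rewrite [RHS]mxE -oa !mxE.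
  by apply: eq_bigr => i _; rewrite !mxE.
rewrite -(sum_ord2 (fun k => proj2 (a k))) -(mulmx1C AA); apply/matrixP => i j.
rewrite summxE mxE; apply: eq_bigr => k _.
by rewrite !mxE big_ord1 !mxE.
Qed.

(** * Pinching and reflections *)

Definition pinch n (P Q X : 'M[C]_n) := P *m X *m P + Q *m X *m Q.

Lemma pinchB n (P Q X Y : 'M[C]_n) : pinch P Q (X - Y) = pinch P Q X - pinch P Q Y.
Proof. by rewrite /pinch !mulmxBr !mulmxBl opprD addrACA. Qed.

Lemma adjmx_pinch n (P Q X : 'M[C]_n) : adjmx P = P -> adjmx Q = Q ->
  adjmx (pinch P Q X) = pinch P Q (adjmx X).
Proof. by move=> hP hQ; rewrite /pinch adjmxD !adjmxM hP hQ !mulmxA. Qed.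

(** Both sides equal the off-diagonal blocks [P *m X *m Q + Q *m X *m P]. *)
Lemma pinch_reflection n (P Q X : 'M[C]_n) : P + Q = 1%:M ->
  X - pinch P Q X = 2^-1 *: (X - (P - Q) *m X *m (P - Q)).
Proof.
move=> PQ1; have defX : X = (P + Q) *m X *m (P + Q) by rewrite PQ1 mul1mx mulmx1.
rewrite /pinch {1 4}defX !mulmxDl !mulmxDr !mulNmx !mulmxN.
move: (P *m X *m P) (P *m X *m Q) (Q *m X *m P) (Q *m X *m Q) => A B D E.
by apply/matrixP => i j; rewrite !mxE; field.
Qed.

Lemma reflection_sqr n (P Q : 'M[C]_n) :
  P *m P = P -> Q *m Q = Q -> P *m Q = 0 -> Q *m P = 0 ->
  (P - Q) *m (P - Q) = P + Q.
Proof.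
by move=> PP QQ PQ QP; rewrite mulmxBl !mulmxBr PP QQ PQ QP subr0 sub0r opprK.
Qed.

Definition local_proj n (v : 'cV[C]_2) : 'M[C]_(2 * n) := proj2 v *t 1%:M.

Lemma adjmx_local_proj n v : adjmx (local_proj n v) = local_proj n v.
Proof. by rewrite /local_proj adjmx_tens adjmx_proj2 adjmx1. Qed.

Lemma local_projM n (a : 'I_2 -> 'cV[C]_2) j k : orthonormal2 a ->
  local_proj n (a j) *m local_proj n (a k) = if j == k then local_proj n (a j) else 0.
Proof.
move=> oa; rewrite /local_proj tensmx_mul mulmx1 proj2M //.
by case: eqP; rewrite ?tens0mx.
Qed.

Lemma sum_local_proj n (a : 'I_2 -> 'cV[C]_2) : orthonormal2 a ->
  local_proj n (a 0) + local_proj n (a 1) = 1%:M.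
Proof. by move=> oa; rewrite /local_proj -tensmxDl sum_proj2 // tensmx11. Qed.

Lemma dephaseE n (a : 'I_2 -> 'cV[C]_2) (X : 'M[C]_(2 * n)) :
  dephase a X = pinch (local_proj n (a 0)) (local_proj n (a 1)) X.
Proof. exact: sum_ord2. Qed.

Lemma adjmx_dephase n (a : 'I_2 -> 'cV[C]_2) (X : 'M[C]_(2 * n)) :
  adjmx (dephase a X) = dephase a (adjmx X).
Proof. by rewrite !dephaseE adjmx_pinch // adjmx_local_proj. Qed.

Lemma dephase_reflection n (a : 'I_2 -> 'cV[C]_2) : orthonormal2 a ->
  exists Z : 'M[C]_(2 * n), [/\ adjmx Z = Z, Z *m Z = 1%:M &
    forall X, X - dephase a X = 2^-1 *: (X - Z *m X *m Z)].
Proof.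
move=> oa; exists (local_proj n (a 0) - local_proj n (a 1)); split.
- by rewrite adjmxD adjmxN !adjmx_local_proj.
- by rewrite reflection_sqr ?sum_local_proj ?local_projM.
- by move=> X; rewrite dephaseE pinch_reflection // sum_local_proj.
Qed.

Lemma dephase_cq_id n (a : 'I_2 -> 'cV[C]_2) (s : 'I_2 -> 'M[C]_n) :
  orthonormal2 a ->
  dephase a (\sum_(j < 2) proj2 (a j) *t s j) = \sum_(j < 2) proj2 (a j) *t s j.
Proof.
move=> oa; rewrite /dephase; apply: eq_bigr => k _.
rewrite mulmx_sumr mulmx_suml (bigD1 k) //= big1 ?addr0 => [|j /negPf jk].
  by rewrite !tensmx_mul !proj2M // eqxx proj2M // eqxx mul1mx mulmx1.
by rewrite !tensmx_mul !proj2M // eq_sym jk mul0mx tens0mx.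
Qed.

Lemma dephase_optimal n (a : 'I_2 -> 'cV[C]_2) (s : 'I_2 -> 'M[C]_n)
    (rho : 'M[C]_(2 * n)) :
  orthonormal2 a -> (forall j, adjmx (s j) = s j) -> adjmx rho = rho ->
  trnorm (rho - dephase a rho) <= trnorm (rho - \sum_(j < 2) proj2 (a j) *t s j).
Proof.
move=> oa hs hrho; set sigma := \sum_(j < 2) _.
have hsigma : adjmx sigma = sigma.
  by rewrite /sigma sum_ord2 adjmxD !adjmx_tens !adjmx_proj2 !hs.
have [Z [hZ ZZ defZ]] := dephase_reflection n oa.
(* Subtracting [sigma], a fixed point of the dephasing, leaves the residual unchanged. *)
have -> : rho - dephase a rho = (rho - sigma) - dephase a (rho - sigma).
  rewrite (dephaseE a (rho - sigma)) pinchB -!dephaseE dephase_cq_id //.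
  by rewrite opprB addrA subrK.
by rewrite defZ trnorm_pinch_le // adjmxD adjmxN hrho hsigma.
Qed.

(* The isometry [v (x) 1_B] from [B] to [A (x) B]; [v *t 1%:M] itself has
   [1 * n] columns. *)
Definition ket_embed n (v : 'cV[C]_2) : 'M[C]_(2 * n, n) :=
  \matrix_(i, q) (v (mxtens_unindex i).1 0 * ((mxtens_unindex i).2 == q)%:R).

Lemma mul_ket_embed n m v (s : 'M[C]_(n, m)) i q :
  (ket_embed n v *m s) i q = v (mxtens_unindex i).1 0 * s (mxtens_unindex i).2 q.
Proof.
rewrite mxE (bigD1 (mxtens_unindex i).2) //= big1 ?addr0 => [|p /negPf ip].
  by rewrite mxE eqxx mulr1.
by rewrite mxE eq_sym ip mulr0 mul0r.
Qed.

Lemma ket_embed_conj n v (s : 'M[C]_n) :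
  ket_embed n v *m s *m adjmx (ket_embed n v) = proj2 v *t s.
Proof.
apply/matrixP => i j.
(* Taking the adjoint twice brings the right-hand factor to the left, so that [mul_ket_embed]
   evaluates both factors. *)
rewrite -[LHS]conjCK -adjmxE !adjmxM adjmxK mul_ket_embed -adjmxM adjmxE mul_ket_embed.
by rewrite rmorphM /= conjCK !mxE big_ord1 adjmxE mulrC mulrAC.
Qed.

(** The operators on [B] are the diagonal blocks of [rho] in the basis [a]: compressions of a
    positive operator, whose traces add up to that of [rho] by completeness. *)
Lemma dephase_is_cq n (a : 'I_2 -> 'cV[C]_2) (rho : 'M[C]_(2 * n)) :
  orthonormal2 a -> is_state rho -> is_cq (dephase a rho).
Proof.
move=> oa [psd_rho tr_rho]; pose E k := ket_embed n (a k).
have EE k : E k *m adjmx (E k) = proj2 (a k) *t 1%:M.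
  by rewrite -ket_embed_conj mulmx1.
exists a, (fun k => adjmx (E k) *m rho *m E k); split=> //.
- by move=> j; apply: psd_conj.
- rewrite -tr_rho -[in RHS](mul1mx rho) -tensmx11 -(sum_proj2 oa) tensmxDl.
  rewrite -!EE mulmxDl raddfD /= sum_ord2.
  by congr (_ + _); rewrite mxtrace_mulC !mulmxA.
- by apply: eq_bigr => k _; rewrite -EE -ket_embed_conj !mulmxA.
Qed.

End Dephasing.

(** * Continuity *)

Section Continuity.
Local Open Scope classical_set_scope.
Variables (R : realType) (T : topologicalType).
Local Notation C := R[i].
Local Notation Re := (@complex.Re R).
Local Notation Im := (@complex.Im R).

(** Stated through real and imaginary parts, so that only the topology of [R] enters on the target
    side. *)
Definition ccontinuous (f : T -> C) :=
  continuous (fun x => Re (f x)) /\ continuous (fun x => Im (f x)).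

Definition mxcontinuous m n (M : T -> 'M[C]_(m, n)) :=
  forall i j, ccontinuous (fun x => M x i j).

Lemma ccontinuous_cst c : ccontinuous (fun=> c).
Proof. by split=> x; apply: cvg_cst. Qed.

Lemma ccontinuousD f g : ccontinuous f -> ccontinuous g ->
  ccontinuous (fun x => f x + g x).
Proof.
move=> [cf df] [cg dg]; split.
  under [X in continuous X]eq_fun do rewrite Re_add.
  by move=> x; apply: cvgD; [apply: cf | apply: cg].
under [X in continuous X]eq_fun do rewrite Im_add.
by move=> x; apply: cvgD; [apply: df | apply: dg].
Qed.

Lemma ccontinuousM f g : ccontinuous f -> ccontinuous g ->
  ccontinuous (fun x => f x * g x).
Proof.
move=> [cf df] [cg dg]; split.
  under [X in continuous X]eq_fun do rewrite Re_mul.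
  move=> x; apply: cvgB; apply: cvgM;
    [exact: cf | exact: cg | exact: df | exact: dg].
under [X in continuous X]eq_fun do rewrite Im_mul.
by move=> x; apply: cvgD; apply: cvgM; [apply: cf | apply: dg | apply: df | apply: cg].
Qed.

Lemma ccontinuous_conj f : ccontinuous f -> ccontinuous (fun x => Num.conj (f x)).
Proof.
move=> [cf df]; split.
  by under [X in continuous X]eq_fun do rewrite Re_conjc.
under [X in continuous X]eq_fun do rewrite Im_conjc.
by move=> x; apply: cvgN; apply: df.
Qed.

Lemma ccontinuous_sum (I : Type) (r : seq I) (F : I -> T -> C) :
  (forall i, ccontinuous (F i)) -> ccontinuous (fun x => \sum_(i <- r) F i x).
Proof.
move=> cF; elim: r => [|i r IH].
  by under [X in ccontinuous X]eq_fun do rewrite big_nil; exact: ccontinuous_cst.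
by under [X in ccontinuous X]eq_fun do rewrite big_cons; exact: ccontinuousD.
Qed.

Lemma mxcontinuous_cst m n (A : 'M[C]_(m, n)) : mxcontinuous (fun=> A).
Proof. by move=> i j; apply: ccontinuous_cst. Qed.

Lemma mxcontinuousB m n (A B : T -> 'M[C]_(m, n)) :
  mxcontinuous A -> mxcontinuous B -> mxcontinuous (fun x => A x - B x).
Proof.
move=> cA cB i j.
under [X in ccontinuous X]eq_fun do rewrite !mxE -mulN1r.
by apply: ccontinuousD => //; apply: ccontinuousM => //; exact: ccontinuous_cst.
Qed.

Lemma mxcontinuous_sum m n (I : Type) (r : seq I) (A : I -> T -> 'M[C]_(m, n)) :
  (forall i, mxcontinuous (A i)) -> mxcontinuous (fun x => \sum_(i <- r) A i x).
Proof.
move=> cA i j; under [X in ccontinuous X]eq_fun do rewrite summxE.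
by apply: ccontinuous_sum => k; apply: cA.
Qed.

Lemma mxcontinuousM m n p (A : T -> 'M[C]_(m, n)) (B : T -> 'M[C]_(n, p)) :
  mxcontinuous A -> mxcontinuous B -> mxcontinuous (fun x => A x *m B x).
Proof.
move=> cA cB i j; under [X in ccontinuous X]eq_fun do rewrite mxE.
by apply: ccontinuous_sum => k; apply: ccontinuousM.
Qed.

Lemma mxcontinuous_adj m n (A : T -> 'M[C]_(m, n)) :
  mxcontinuous A -> mxcontinuous (fun x => adjmx (A x)).
Proof.
move=> cA i j; under [X in ccontinuous X]eq_fun do rewrite adjmxE.
exact: ccontinuous_conj.
Qed.

Lemma mxcontinuous_tens m n p q (A : T -> 'M[C]_(m, n)) (B : 'M[C]_(p, q)) :
  mxcontinuous A -> mxcontinuous (fun x => A x *t B).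
Proof.
move=> cA i j; under [X in ccontinuous X]eq_fun do rewrite mxE.
by apply: ccontinuousM => //; exact: ccontinuous_cst.
Qed.

Lemma mxcontinuous_dephase n (a : T -> 'I_2 -> 'cV[C]_2) (X : 'M[C]_(2 * n)) :
  (forall k, mxcontinuous (fun x => a x k)) ->
  mxcontinuous (fun x => dephase (a x) X).
Proof.
move=> ca; apply: mxcontinuous_sum => k.
have cP : mxcontinuous (fun x => proj2 (a x k) *t (1%:M : 'M[C]_n)).
  by apply/mxcontinuous_tens/mxcontinuousM => //; exact: mxcontinuous_adj.
apply: mxcontinuousM => //; apply: mxcontinuousM => //; exact: mxcontinuous_cst.
Qed.

Lemma trnorm_continuous n (M : T -> 'M[C]_n) :
  (forall x, adjmx (M x) = M x) -> mxcontinuous M ->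
  continuous (fun x => trnorm (M x)).
Proof.
move=> hM cM x0.
(* [g] is the Lipschitz bound at [x0]. It is continuous and vanishes at [x0], so [trnorm (M x)] is
   squeezed between [trnorm (M x0) - g x] and [trnorm (M x0) + g x]. *)
pose g x := \sum_i Num.sqrt (Re ((adjmx (M x - M x0) *m (M x - M x0)) i i)).
have cg : g x @[x --> x0] --> g x0.
  rewrite /g; apply: cvg_big => [|i _]; first exact: add_continuous.
  apply: (continuous_comp _ (@sqrt_continuous R _)).
  have cD : mxcontinuous (fun x => M x - M x0).
    by apply: mxcontinuousB => //; exact: mxcontinuous_cst.
  by case: (mxcontinuousM (mxcontinuous_adj cD) cD i i) => h _; apply: h.
have g0 : g x0 = 0.
  by rewrite /g subrr big1 // => i _; rewrite mulmx0 mxE sqrtr0.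
apply: (@squeeze_cvgr _ _ _ _ (fun x => trnorm (M x0) - g x)
  (fun x => trnorm (M x0) + g x)).
- near=> x; apply/andP; split.
    rewrite lerBlDl -lerBlDr.
    apply: le_trans (trnorm_lipschitz (hM x0) (hM x)) _.
    by rewrite /g; apply: ler_sum => i _; rewrite -opprB adjmxN mulNmx mulmxN opprK.
  by rewrite -lerBlDl; exact: trnorm_lipschitz.
- by rewrite -[X in _ --> X]subr0 -g0; apply: cvgB => //; exact: cvg_cst.
- by rewrite -[X in _ --> X]addr0 -g0; apply: cvgD => //; exact: cvg_cst.
Unshelve. all: by end_near. Qed.

End Continuity.

(** * Optimal bases *)

Section Sphere.
Local Open Scope classical_set_scope.
Variable R : realType.
Local Notation C := R[i].
Local Notation Re := (@complex.Re R).
Local Notation Im := (@complex.Im R).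

Definition sphere3 : set 'rV[R]_4 := [set x | \sum_i x 0 i ^+ 2 = 1].

(** The four reals encode a unit vector [(u, w)]; [(- conj w, conj u)] is a unit vector orthogonal
    to it that depends continuously on it. *)
Definition sphere_basis (x : 'rV[R]_4) (k : 'I_2) : 'cV[C]_2 :=
  let u := Complex (x 0 0) (x 0 1) in
  let w := Complex (x 0 2) (x 0 3) in
  \col_i (if k == 0 then if i == 0 then u else w
          else if i == 0 then - Num.conj w else Num.conj u).

Lemma sum_ord4 (V : nmodType) (F : 'I_4 -> V) : \sum_k F k = F 0 + F 1 + F 2 + F 3.
Proof.
rewrite !big_ord_recl big_ord0 addr0 !addrA.
by congr (F _ + F _ + F _ + F _); exact: val_inj.
Qed.

Lemma ord2P (P : 'I_2 -> Prop) : P 0 -> P 1 -> forall k, P k.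
Proof.
move=> P0 P1 [[|[|//]] lek]; first by rewrite (_ : Ordinal lek = 0) //; exact: val_inj.
by rewrite (_ : Ordinal lek = 1) //; exact: val_inj.
Qed.

Lemma sphere_basis_orthonormal x : sphere3 x -> orthonormal2 (sphere_basis x).
Proof.
rewrite /sphere3 /= sum_ord4 => x1.
by elim/ord2P; elim/ord2P; rewrite mxE sum_ord2 !mxE /=;
  apply/eqP; rewrite eq_complex; apply/andP; split; apply/eqP => /=; rewrite -?x1; ring.
Qed.

(** Only the first vector is matched: the second is determined by it up to a phase, which
    [dephase_eq] absorbs. *)
Lemma sphere_basis_surj (a : 'I_2 -> 'cV[C]_2) : orthonormal2 a ->
  exists2 x, sphere3 x & sphere_basis x 0 = a 0.
Proof.
move=> oa.
pose x : 'rV[R]_4 := \row_i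
  [:: Re (a 0 0 0); Im (a 0 0 0); Re (a 0 1 0); Im (a 0 1 0)]`_i.
exists x.
  have := congr1 Re (oa 0 0); rewrite mxE sum_ord2 !adjmxE Re_add.
  rewrite 2![Num.conj _ * _]mulrC !Re_mul_conj /= => a1.
  by rewrite /sphere3 /= sum_ord4 !mxE /= -[RHS]a1; ring.
apply/colP; elim/ord2P; rewrite !mxE /=; last by case: (a 0 1 0).
by case: (a 0 0 0).
Qed.

(** By completeness the second projector is the identity minus the first. *)
Lemma dephase_eq n (a b : 'I_2 -> 'cV[C]_2) (X : 'M[C]_(2 * n)) :
  orthonormal2 a -> orthonormal2 b -> a 0 = b 0 -> dephase a X = dephase b X.
Proof.
move=> oa ob ab.
suff ab1 : local_proj n (a 1) = local_proj n (b 1) by rewrite !dephaseE ab ab1.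
apply: (addrI (local_proj n (b 0))); rewrite (sum_local_proj n ob) -ab.
exact: sum_local_proj.
Qed.

(** The norm on row vectors is the maximum of the absolute entries, each at most 1 on the sphere;
    closedness comes from a continuous preimage of a point. *)
Lemma sphere3_compact : compact sphere3.
Proof.
apply: bounded_closed_compact.
  exists 1; split; first exact: num_real.
  move=> M M1 x; rewrite /sphere3 /= => x1; apply: le_trans (ltW M1).
  rewrite [leLHS]mx_normrE; apply/bigmax_leP; split=> [|[i j] _] /=; first exact: ler01.
  rewrite ord1 -(@expr_le1 _ 2) // real_normK ?num_real //.
  rewrite -x1 (bigD1 j) //= lerDl; apply: sumr_ge0 => k _; exact: sqr_ge0.
have c : continuous (fun x : 'rV[R]_4 => \sum_i x 0 i ^+ 2).
  apply: continuous_big => [|i _ x]; first exact: add_continuous.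
  have ci := @coord_continuous R 1 4 0 i x.
  exact: (cvgM ci ci).
have -> : sphere3 = (fun x : 'rV[R]_4 => \sum_i x 0 i ^+ 2) @^-1` [set 1] by [].
by apply: closed_comp => [x _|]; [exact: c | exact: closed_eq].
Qed.

Lemma sphere_basis_continuous k : mxcontinuous (fun x => sphere_basis x k).
Proof.
have cu (i j : 'I_4) : ccontinuous (fun x : 'rV[R]_4 => Complex (x 0 i) (x 0 j)).
  by split=> x; exact: coord_continuous.
have cN (f : 'rV[R]_4 -> C) : ccontinuous f -> ccontinuous (fun x => - f x).
  move=> cf; under [X in ccontinuous X]eq_fun do rewrite -mulN1r.
  by apply: ccontinuousM => //; exact: ccontinuous_cst.
move=> i j; under [X in ccontinuous X]eq_fun do rewrite mxE.
case: (k == 0); case: (i == 0) => //; last exact: ccontinuous_conj.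
by apply: cN; exact: ccontinuous_conj.
Qed.

Lemma min_dephase_attained n (rho : 'M[C]_(2 * n)) : adjmx rho = rho ->
  exists2 a0 : 'I_2 -> 'cV[C]_2, orthonormal2 a0 & forall a, orthonormal2 a ->
    trnorm (rho - dephase a0 rho) <= trnorm (rho - dephase a rho).
Proof.
move=> hrho.
have c : continuous (fun x => trnorm (rho - dephase (sphere_basis x) rho)).
  apply: trnorm_continuous => [x|]; first by rewrite adjmxD adjmxN adjmx_dephase hrho.
  apply: mxcontinuousB; first exact: mxcontinuous_cst.
  by apply: mxcontinuous_dephase => k; exact: sphere_basis_continuous.
have ne : sphere3 !=set0.
  exists (\row_i (i == 0)%:R); rewrite /sphere3 /= sum_ord4 !mxE /=; ring.
have [x0 /set_mem x0S minx0] := EVT_min_rV ne sphere3_compact (continuous_subspaceT c).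
exists (sphere_basis x0); first exact: sphere_basis_orthonormal.
move=> a oa; have [x xS xa] := sphere_basis_surj oa.
(* The basis [a] is traded for the sphere basis with the same first vector, where the minimum over
   the sphere applies. *)
rewrite -(dephase_eq rho (sphere_basis_orthonormal xS) oa xa).
exact/minx0/mem_set.
Qed.

End Sphere.

(* Both minima are attained and coincide. *)
Theorem theorem8 (R : realType) (n : nat) (rho : 'M[R[i]]_(2 * n)) :
  is_state rho ->
  exists (a0 : 'I_2 -> 'cV[R[i]]_2) (s0 : 'M[R[i]]_(2 * n)),
    [/\ orthonormal2 a0,
        (forall a, orthonormal2 a ->
           trnorm (rho - dephase a0 rho) <= trnorm (rho - dephase a rho)),
        is_cq s0,
        (forall s, is_cq s -> trnorm (rho - s0) <= trnorm (rho - s)) &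
        trnorm (rho - dephase a0 rho) = trnorm (rho - s0)].
Proof.
move=> rho_state; have [[hrho _] _] := rho_state.
have [a0 oa0 min_a0] := min_dephase_attained hrho.
exists a0, (dephase a0 rho); split=> //; first exact: dephase_is_cq.
(* The competitor [s] is compared with the dephasing of [rho] in the basis of [s], and that with the
   optimal basis [a0]. *)
move=> s [a [sj [oa psd_sj _ ->]]]; apply: le_trans (min_a0 a oa) _.
by apply: dephase_optimal => // j; case: (psd_sj j).
Qed.
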